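(* Fix an integer $k\ge 1$. (a) Suppose that $(t_{k,n})_{n\ge 1}$ is a sequence of finite rooted trees converging locally to an infinite tree without leaves. Then, as $n\to\infty$, $$P_k[t_{k,n}](\mathrm{True})=P_k[t_{k,n}](\mathrm{False})\to \frac12 .$$ (b) Conversely, if $(t_{k,n})_{n\ge 1}$ is a sequence of finite rooted trees converging locally to a tree with at least one leaf, then there exists a $k$-variable Boolean function $f\notin\{\mathrm{True},\mathrm{False}\}$ such that $$\liminf_{n\to\infty} P_k[t_{k,n}](f)>0 .$$
   Context: All trees are rooted and contain no node having exactly one child. A $k$-variable Boolean function is a map $\{\mathrm{False},\mathrm{True}\}^k\to\{\mathrm{False},\mathrm{True}\}$; $\mathrm{True}$ and $\mathrm{False}$ also denote the two constant functions. A $k$-variable and/or tree is a finite rooted tree whose internal nodes are labelled by $\land$ or $\lor$ and whose leaves are labelled by literals in $\{x_1,\bar x_1,\dots,x_k,\bar x_k\}$ ($\bar x_i$ is the negation of $x_i$); evaluating it from the leaves to the root (each internal node being the conjunction, resp. disjunction, of its children) gives the Boolean function $\mathrm{f}[\tau]$ represented by the and/or tree $\tau$. For a finite tree $t$, its randomly $k$-labelled version $\hat t$ is obtained by giving, independently, each internal node a uniform label in $\{\land,\lor\}$ and each leaf a uniform label in $\{x_1,\bar x_1,\dots,x_k,\bar x_k\}$. For a Boolean function $g$, $P_k[t](g)$ is the probability that $\mathrm{f}[\hat t]=g$. For a rooted tree $t$ and $h\ge0$, $t^h$ is the subtree induced on the nodes at distance at most $h$ from the root. A sequence $(t_n)_{n\ge1}$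 converges locally to a tree $t$ if for every $h\ge 1$ there is $n_h$ such that for all $n\ge n_h$ the truncations $t_n^h$ and $t^h$ are isomorphic (as rooted trees). *)

(* Defs.v *)
From HB Require Import structures.
From mathcomp Require Import all_boot all_order all_algebra.
From mathcomp Require Import all_classical all_reals all_analysis.
Set Implicit Arguments.
Unset Strict Implicit.
Unset Printing Implicit Defensive.
Import Order.TTheory GRing.Theory Num.Theory.
Local Open Scope ring_scope.

(* A rooted tree on the vertex type [V], given by its parent map.  By         *)
(* convention the root is its own parent; since every vertex reaches the root *)
(* by iterating [parent], the root is the only fixed point and there are no   *)
(* cycles.  Finite trees are those with [V : finType].                        *)
Record rtree (V : eqType) := RTree {
  troot : V;
  parent : V -> V;
  parent_root : parent troot = troot;
  reach_root : forall v, exists n, iter n parent v == troot }.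

Section RootedTree.
Variables (V : eqType) (t : rtree V).

Definition child (v u : V) : bool := (u != troot t) && (parent t u == v).

Definition is_leaf (v : V) : Prop := forall u, ~~ child v u.

Definition no_unary_node : Prop := forall v, ~ exists! u, child v u.

Definition depth (v : V) : nat := ex_minn (reach_root t v).

Lemma depth_root : depth (troot t) = 0%N.
Proof.
rewrite /depth; case: ex_minnP => m _ /(_ 0%N) /=; rewrite eqxx.
by move=> /(_ isT); rewrite leqn0 => /eqP.
Qed.

Lemma depth_parent (v : V) : (depth (parent t v) <= depth v)%N.
Proof.
rewrite /depth; case: ex_minnP => m _ mmin; case: ex_minnP => n /eqP nv _.
by apply: mmin; rewrite -iterSr iterS nv parent_root.
Qed.

End RootedTree.

Section Truncation.
Variables (V : eqType) (t : rtree V) (h : nat).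

Definition trunc_node := {v : V | (depth t v <= h)%N}.

Lemma trunc_root_subproof : (depth t (troot t) <= h)%N.
Proof. by rewrite depth_root. Qed.

Definition trunc_root : trunc_node := exist _ (troot t) trunc_root_subproof.

Definition trunc_parent (v : trunc_node) : trunc_node :=
  exist _ (parent t (val v)) (leq_trans (depth_parent t (val v)) (valP v)).

Lemma trunc_parent_root : trunc_parent trunc_root = trunc_root.
Proof. by apply/val_inj; rewrite /= parent_root. Qed.

Lemma trunc_reach_root (v : trunc_node) :
  exists n, iter n trunc_parent v == trunc_root.
Proof.
have [n nv] := reach_root t (val v); exists n; rewrite -val_eqE /=.
suff -> : val (iter n trunc_parent v) = iter n (parent t) (val v) by [].
by elim: n {nv} => //= n <-.
Qed.

Definition trunc : rtree trunc_node :=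
  RTree trunc_parent_root trunc_reach_root.

End Truncation.

Definition rtree_iso (V W : eqType) (s : rtree V) (t : rtree W) : Prop :=
  exists phi : V -> W,
    [/\ bijective phi, phi (troot s) = troot t &
        forall v, phi (parent s v) = parent t (phi v)].

Definition converges_locally (V : nat -> finType)
    (t : forall n, rtree (V n)) (W : eqType) (s : rtree W) : Prop :=
  forall h, (1 <= h)%N -> exists N, forall n, (N <= n)%N ->
    rtree_iso (trunc (t n) h) (trunc s h).

Definition boolfun (k : nat) := {ffun {ffun 'I_k -> bool} -> bool}.

Definition TrueF (k : nat) : boolfun k := [ffun => true].
Definition FalseF (k : nat) : boolfun k := [ffun => false].

(* [true] stands for the conjunction, [false] for the disjunction. *)
Definition connective := bool.

(* [(i, true)] stands for x_i and [(i, false)] for its negation. *)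
Definition literal (k : nat) := ('I_k * bool)%type.

Definition label (k : nat) := (connective + literal k)%type.

Section AndOrTree.
Variables (k : nat) (V : finType) (t : rtree V).

Definition well_labelled (l : {ffun V -> label k}) : bool :=
  [forall v, if l v is inr _ then [forall u, ~~ child t v u]
             else [exists u, child t v u]].

Definition labellings : {set {ffun V -> label k}} :=
  [set l | well_labelled l].

Definition lit_val (x : literal k) (a : {ffun 'I_k -> bool}) : bool :=
  if x.2 then a x.1 else ~~ a x.1.

(* The first argument is only a recursion bound: paths going down from the    *)
(* root have at most [#|V|] vertices, so with [#|V|] the default value is     *)
(* never reached on a well-labelled tree.                                     *)
Fixpoint node_val (fuel : nat) (l : {ffun V -> label k})
    (a : {ffun 'I_k -> bool}) (v : V) : bool :=
  match l v, fuel with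
  | inr x, _ => lit_val x a
  | inl true, m.+1 => [forall u, child t v u ==> node_val m l a u]
  | inl false, m.+1 => [exists u, child t v u && node_val m l a u]
  | inl _, 0 => false
  end.

Definition represented (l : {ffun V -> label k}) : boolfun k :=
  [ffun a => node_val #|V| l a (troot t)].

(* Independent uniform labels amount to a uniform choice in [labellings],     *)
(* which is the product over the vertices of the sets of admissible labels.   *)
Definition Pk (R : realType) (g : boolfun k) : R :=
  #|[set l in labellings | represented l == g]|%:R / #|labellings|%:R.

End AndOrTree.
Arguments Pk k {V} t R g.

(* Main.v *)
Require Import Defs.
From HB Require Import structures.
From mathcomp Require Import all_boot all_order all_algebra perm.
From mathcomp Require Import all_classical all_reals all_analysis.
From mathcomp Require Import ring lra zify.
Set Implicit Arguments.
Unset Strict Implicit.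
Unset Printing Implicit Defensive.
Import Order.TTheory GRing.Theory Num.Theory.
Import numFieldNormedType.Exports.
Local Open Scope ring_scope.

(* Swapping the two connectives and negating all literals preserves the law of
   the labelling and negates the value of every node, so True and False are
   equally likely.

   (a) For two assignments a, b let q_v be the probability that the values of
   the node v at a and b differ.  By this symmetry and independence of the
   subtrees, a node with children u_1, ..., u_d satisfies
   q_v = 2 (2^-d - prod_i (1 - q_(u_i)) / 2), and since d >= 2 a common bound
   q_(u_i) <= x gives q_v <= x - x^2 / 2.  Iterating this from depth h up to
   the root yields q_root <= 2 / (h + 2); a union bound over the pairs (a, b)
   shows that the function is constant with probability tending to 1.

   (b) The function is f = x_1.  Every node of a tree without unary nodes has a
   value >= x_1 with probability at least p = 1/(2k): this holds at a leaf, and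
   at a node with d children the conjunction and the disjunction contribute
   together at least (p^d + 1 - (1 - p)^d) / 2 >= p.  Hence a node computes x_1
   as soon as it is a conjunction, one chosen child computes x_1 and the other
   children are >= x_1; following the path from a leaf of the limit tree up to
   the root bounds P(f) below in terms of a truncation of the limit tree. *)

(** * Depth along the parent map *)

Section Depth.
Context (V : eqType) (t : rtree V).

Lemma iter_depth v : iter (depth t v) (parent t) v = troot t.
Proof. by rewrite /depth; case: ex_minnP => m /eqP. Qed.

Lemma depth_le n v : iter n (parent t) v = troot t -> (depth t v <= n)%N.
Proof. by rewrite /depth; case: ex_minnP => m _ mmin /eqP; apply: mmin. Qed.

Lemma depth_child v u : child t v u -> depth t u = (depth t v).+1.
Proof.
case/andP=> u_nroot /eqP <-; apply/eqP; rewrite eqn_leq; apply/andP; split.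
  by apply: depth_le; rewrite iterSr iter_depth.
have := iter_depth u; case: (depth t u) => [/= u_root|d].
  by rewrite u_root eqxx in u_nroot.
by rewrite iterSr => /depth_le.
Qed.

Lemma depth_iter n v : (depth t (iter n (parent t) v) <= depth t v)%N.
Proof. by elim: n => //= n; apply/leq_trans/depth_parent. Qed.

(** A positive iterate of [parent] from [u] is [v] or an ancestor of [v], hence at most as deep as
    [v], whereas [u'] lies one level deeper. *)
Lemma child_iter v u u' n :
  child t v u -> child t v u' -> iter n (parent t) u = u' -> n = 0%N.
Proof.
move=> vu vu'; case: n => // n; rewrite iterSr.
have /andP[_ /eqP->] := vu => vnu'.
by have := depth_iter n v; rewrite vnu' (depth_child vu') ltnn.
Qed.

End Depth.

(** * Bottom-up induction and subtrees of a finite tree *)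

Section FiniteTree.
Context (V : finType) (t : rtree V).

Lemma depth_lt_card v : (depth t v < #|V|)%N.
Proof.
have v_root : fconnect (parent t) v (troot t).
  by rewrite -(iter_depth t v) fconnect_iter.
apply: leq_ltn_trans (leq_trans (findex_max v_root) (max_card _)).
by apply: depth_le; rewrite iter_findex.
Qed.

(** Passing to a child decreases [#|V| - depth t v], which is positive since depths stay below
    [#|V|]. *)
Lemma child_ind (P : V -> Prop) :
  (forall v, (forall u, child t v u -> P u) -> P v) -> forall v, P v.
Proof.
move=> IH v; have [n] := ubnP (#|V| - depth t v); elim: n v => // n IHn v lt_n.
apply: IH => u vu; apply: IHn.
have := depth_lt_card v; rewrite (depth_child vu); lia.
Qed.

Definition desc (v : V) : {set V} := [set u | fconnect (parent t) u v].

Lemma desc_refl v : v \in desc v.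
Proof. by rewrite inE connect0. Qed.

Lemma desc_child v u : child t v u -> desc u \subset desc v.
Proof.
case/andP=> _ /eqP uv; apply/fintype.subsetP => w; rewrite !inE => wu.
by apply: connect_trans wu _; rewrite -uv fconnect1.
Qed.

Lemma notin_desc_child v u : child t v u -> v \notin desc u.
Proof.
move=> vu; rewrite inE; apply/negP => /iter_findex vnu.
by have := depth_iter t (findex (parent t) v u) v;
   rewrite vnu (depth_child vu) ltnn.
Qed.

(** The ancestors of a common descendant form a chain, so one of [u], [u'] would be an iterated
    parent of the other; [child_iter] then makes them equal. *)
Lemma desc_disjoint v u u' :
  child t v u -> child t v u' -> u != u' -> [disjoint desc u & desc u'].
Proof.
move=> vu vu' /eqP nuu'; apply/pred0Pn => -[w /=]; rewrite !inE.
move=> /andP[/iter_findex + /iter_findex].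
set i := findex _ _ u; set j := findex _ _ u' => wu wu'; apply: nuu'.
have [ij|/ltnW ji] := leqP i j.
  move: wu'; rewrite -(subnK ij) iterD wu => /[dup] uu'.
  by move/(child_iter vu vu') => d0; rewrite d0 in uu'.
move: wu; rewrite -(subnK ji) iterD wu' => /[dup] uu'.
by move/(child_iter vu' vu) => d0; rewrite d0 in uu'.
Qed.

End FiniteTree.

(** * The uniform measure on labellings, symmetries and independence *)

Section Probability.
Context (R : realType) (k : nat) (k_gt0 : (0 < k)%N).
Context (V : finType) (t : rtree V).
Local Notation lab := {ffun V -> label k}.
Implicit Types (E F G : pred lab) (l : lab) (B : {set V}).

Definition prob E : R :=
  #|[set l in labellings k t | E l]|%:R / #|labellings k t|%:R.

(** The vertexwise form of [well_labelled]: it exhibits [labellings] as a product set, so labels can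
    be mixed or changed vertex by vertex. *)
Definition admissible (v : V) : pred (label k) := fun y =>
  if y is inr _ then [forall u, ~~ child t v u] else [exists u, child t v u].

Lemma labellingsP l :
  reflect (forall v, admissible v (l v)) (l \in labellings k t).
Proof.
rewrite inE; apply: (iffP forallP) => h v; move: (h v); rewrite /admissible;
  by case: (l v).
Qed.

Lemma card_labellings_gt0 : (0 < #|labellings k t|)%N.
Proof.
apply/card_gt0P; exists [ffun v => if [exists u, child t v u] then inl true
  else inr (Ordinal k_gt0, true)]; apply/labellingsP => v; rewrite ffunE.
by case: ifPn => // /existsPn vl; apply/forallP.
Qed.

Lemma eq_prob E F : {in labellings k t, E =1 F} -> prob E = prob F.
Proof.
move=> EF; congr (#|pred_of_set _|%:R / _); apply/setP => l; rewrite !inE.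
by case: (boolP (well_labelled _ _)) => //= wl; apply: EF; rewrite inE.
Qed.

Lemma prob_ge0 E : 0 <= prob E.
Proof. by rewrite divr_ge0. Qed.

Lemma prob_pred0 E : E =1 xpred0 -> prob E = 0.
Proof.
move=> E0; rewrite /prob (_ : finset _ = finset.set0) ?cards0 ?mul0r//.
by apply/setP => l; rewrite !inE E0 andbF.
Qed.

Lemma prob_predT : prob xpredT = 1.
Proof.
rewrite /prob (_ : finset _ = labellings k t).
  by rewrite divff// pnatr_eq0 -lt0n card_labellings_gt0.
by apply/setP => l; rewrite !inE andbT.
Qed.

Lemma prob_split F E :
  prob E = prob (fun l => E l && F l) + prob (fun l => E l && ~~ F l).
Proof.
rewrite /prob -mulrDl -natrD -cardsUI.
rewrite [X in (_ + #|pred_of_set X|)%N](_ : _ = finset.set0) ?cards0 ?addn0.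
  congr (#|pred_of_set _|%:R / _); apply/setP => l; rewrite !inE /=.
  by case: well_labelled => //=; case: (E l) => //=; case: (F l).
apply/setP => l; rewrite !inE /=.
by case: (F l); rewrite ?andbF// andbT andbF.
Qed.

Lemma prob_predC E : prob (fun l => ~~ E l) = 1 - prob E.
Proof.
by rewrite -prob_predT (prob_split E xpredT) [prob _ + _]addrC addrK.
Qed.

Lemma le_prob E F : subpred E F -> prob E <= prob F.
Proof.
move=> EF; rewrite /prob ler_wpM2r ?invr_ge0// ler_nat subset_leq_card//.
by apply/fintype.subsetP => l; rewrite !inE => /andP[-> /EF].
Qed.

Lemma prob_le1 E : prob E <= 1.
Proof. by rewrite -prob_predT le_prob. Qed.

Lemma prob_exists (I : finType) (E : I -> pred lab) :
  prob (fun l => [exists i, E i l]) <= \sum_i prob (E i).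
Proof.
apply: (@le_trans _ _ (prob (fun l => has (E^~ l) (enum I)))).
  apply: le_prob => l /existsP[i Eil]; apply/hasP.
  by exists i; rewrite ?mem_enum.
rewrite -big_enum /=; elim: (enum I) => [|i s IHs].
  by rewrite prob_pred0 ?big_nil.
rewrite big_cons (prob_split (E i)) lerD ?le_prob// => [l /andP[]//|].
apply: le_trans IHs; apply: le_prob => l /=.
by case: (E i l); rewrite /= ?andbF ?andbT.
Qed.

Lemma in_event E l :
  (l \in [set l in labellings k t | E l]) = (l \in labellings k t) && E l.
Proof. by rewrite finset.in_set. Qed.

Lemma prob_involution (phi : lab -> lab) E : involutive phi ->
  {homo phi : l / l \in labellings k t} -> prob (E \o phi) = prob E.
Proof.
move=> phiK phi_lab; congr (_%:R / _).
rewrite -[RHS](card_imset _ (inv_inj phiK)); congr #|pred_of_set _|.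
apply/setP => l; rewrite -[in RHS](phiK l) (mem_imset _ _ (inv_inj phiK)).
rewrite !in_event /=; congr andb.
by apply/idP/idP => /phi_lab//; rewrite phiK.
Qed.

Definition depends_on B E :=
  forall l l', {in B, l =1 l'} -> E l = E l'.

Definition mix B (l l' : lab) : lab :=
  [ffun v => if v \in B then l v else l' v].

(* Exchanging the coordinates outside [B] between two independent copies is a
   measure-preserving involution. *)
Lemma prob_indep B E F : depends_on B E -> depends_on (~: B) F ->
  prob (fun l => E l && F l) = prob E * prob F.
Proof.
move=> EB FB; pose sw (p : lab * lab) := (mix B p.1 p.2, mix B p.2 p.1).
have swK : involutive sw.
  case=> l l'; rewrite /sw /=; congr pair; apply/ffunP => v;
    by rewrite !ffunE; case: (v \in B).
pose A E F := finset.setX [set l in labellings k t | E l]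
                          [set l in labellings k t | F l].
have mixL l l' : l \in labellings k t -> l' \in labellings k t ->
    mix B l l' \in labellings k t.
  move=> /labellingsP h /labellingsP h'; apply/labellingsP => v.
  by rewrite ffunE; case: ifP.
have Emix l l' : E (mix B l l') = E l.
  by apply: EB => v vB; rewrite ffunE vB.
have Fmix l l' : F (mix B l l') = F l'.
  by apply: FB => v; rewrite ffunE inE => /negPf ->.
(* Comparing cardinalities on both sides gives |E and F| |all| = |E| |F|, which is the claim after
   division. *)
have swA : sw @: A (fun l => E l && F l) xpredT = A E F.
  apply/setP => p; rewrite -[in LHS](swK p) (mem_imset _ _ (inv_inj swK)).
  case: p => l l'; rewrite !finset.in_setX !in_event /= Emix Fmix andbT.
  have mixK : mix B (mix B l l') (mix B l' l) = l.
    by apply/ffunP => v; rewrite !ffunE; case: (v \in B).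
  have mixK' : mix B (mix B l' l) (mix B l l') = l'.
    by apply/ffunP => v; rewrite !ffunE; case: (v \in B).
  apply/idP/idP =>
    [/andP[/and3P[hl -> ->] hl']|/andP[/andP[hl ->] /andP[hl' ->]]].
    by move: (mixL _ _ hl hl') (mixL _ _ hl' hl); rewrite mixK mixK' => -> ->.
  by rewrite !mixL.
have := congr1 (fun X : {set _} => #|X|) swA.
rewrite (card_imset _ (inv_inj swK)) !cardsX => /(congr1 (fun n => n%:R : R)).
rewrite !natrM => h.
have -> : prob (fun l => E l && F l) =
          prob (fun l => E l && F l) * prob xpredT.
  by rewrite prob_predT mulr1.
by rewrite /prob mulf_div h -mulf_div.
Qed.

End Probability.

(** * The law of one label, the negation symmetry and node values *)

Section Labels.
Context (R : realType) (k : nat) (k_gt0 : (0 < k)%N).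
Context (V : finType) (t : rtree V).
Local Notation lab := {ffun V -> label k}.
Local Notation Pr := (prob R t).
Implicit Types (E F G : pred lab) (l : lab) (B : {set V}).

(** The children are split off one at a time: sibling subtrees are disjoint, so the remaining events
    depend only on labels outside [desc t u]. *)
Lemma prob_all_children v (s : seq V) (E : V -> pred lab) :
    uniq s -> all (child t v) s ->
    (forall u, child t v u -> depends_on (desc t u) (E u)) ->
  Pr (fun l => all (E^~ l) s) = \prod_(u <- s) Pr (E u).
Proof.
move=> + + Edesc; elim: s => [|u s IHs] /=; first by rewrite big_nil prob_predT.
move=> /andP[us s_uniq] /andP[vu vs]; rewrite big_cons -IHs//.
apply: (@prob_indep _ _ k_gt0 _ _ (desc t u)); first exact: Edesc.
move=> l l' ll'; apply: eq_in_all => w ws.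
have vw : child t v w by move/allP: vs; apply.
apply: (Edesc _ vw) => x xw; apply: ll'; rewrite inE.
have wu : w != u by apply: contraNneq us => <-.
by have /disjointFr-> := desc_disjoint vw vu wu.
Qed.

Lemma prob_children v (E : V -> pred lab) :
    (forall u, child t v u -> depends_on (desc t u) (E u)) ->
  Pr (fun l => [forall u, child t v u ==> E u l]) =
  \prod_(u | child t v u) Pr (E u).
Proof.
move=> Edesc; rewrite -(big_enum _ _ (child t v)) /=.
rewrite -(@prob_all_children v) ?enum_uniq//; last first.
  by apply/allP => u; rewrite mem_enum.
apply: eq_prob => l _; apply/forall_inP/allP => /= h u vu; apply: h => //;
  by rewrite mem_enum in vu *.
Qed.

Lemma prob_label_children v y (E : V -> pred lab) :
    (forall u, child t v u -> depends_on (desc t u) (E u)) ->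
  Pr (fun l => (l v == y) && [forall u, child t v u ==> E u l]) =
  Pr (fun l => l v == y) * \prod_(u | child t v u) Pr (E u).
Proof.
move=> Edesc; rewrite -prob_children//.
apply: (@prob_indep _ _ k_gt0 _ _ [set v]) => l l' ll'.
  by rewrite ll' ?set11.
apply: eq_forallb_in => u vu; apply: Edesc => // w wu; apply: ll'.
rewrite !inE; apply: contraTneq wu => ->; exact: notin_desc_child.
Qed.

Lemma prob_total (T : finType) (f : lab -> T) :
  \sum_y Pr (fun l => f l == y) = 1.
Proof.
rewrite -(prob_predT R k_gt0 t) /prob -mulr_suml -natr_sum; congr (_%:R / _).
rewrite -[RHS]sum1_card (partition_big f xpredT)//=; apply: eq_bigr => y _.
by rewrite -sum1_card; apply: eq_bigl => l; rewrite !in_event andbT.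
Qed.

Lemma prob_not_admissible v y :
  ~~ admissible t v y -> Pr (fun l => l v == y) = 0.
Proof.
move=> nvy; rewrite -(@prob_pred0 R k _ t xpred0)//; apply: eq_prob => l.
by move=> /labellingsP/(_ v); apply: contraTF => /eqP ->.
Qed.

(** Transposing [y] and [y'] at the single vertex [v] is an involution of the labellings that
    exchanges the two events. *)
Lemma prob_admissible v y y' : admissible t v y -> admissible t v y' ->
  Pr (fun l => l v == y) = Pr (fun l => l v == y').
Proof.
move=> vy vy'.
pose phi l : lab := [ffun u => if u == v then tperm y y' (l u) else l u].
have phiK : involutive phi.
  move=> l; apply/ffunP => u.
  by rewrite !ffunE; case: (u == v); rewrite ?tpermK.
rewrite -(@prob_involution R k _ t phi)//; last first.
  move=> l /labellingsP hl; apply/labellingsP => u; rewrite ffunE.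
  by case: eqP => // ->; case: tpermP.
by apply: eq_prob => l _;
   rewrite /= ffunE eqxx (can2_eq (tpermK _ _) (tpermK _ _)) tpermL.
Qed.

Lemma prob_connective v c :
  (exists u, child t v u) -> Pr (fun l => l v == inl c) = 1 / 2.
Proof.
move=> /existsP v_int; have := prob_total (fun l => l v).
rewrite big_sumType /= [X in _ + X]big1 => [|x _]; last first.
  rewrite prob_not_admissible//= negb_forall.
  by under eq_existsb do rewrite negbK.
rewrite addr0 (eq_bigr (fun=> Pr (fun l => l v == inl c))) => [|c' _].
  by rewrite sumr_const card_bool -mulr_natl => h; lra.
exact: prob_admissible.
Qed.

Lemma prob_literal v x :
  is_leaf t v -> Pr (fun l => l v == inr x) = (2 * k)%:R^-1.
Proof.
move=> /forallP v_leaf; have := prob_total (fun l => l v).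
rewrite big_sumType /= [X in X + _]big1 => [|c _]; last first.
  by rewrite prob_not_admissible//= negb_exists.
rewrite add0r (eq_bigr (fun=> Pr (fun l => l v == inr x))); last first.
  by move=> x' _; exact: prob_admissible.
rewrite sumr_const card_prod card_ord card_bool mulnC => h.
have k2_neq0 : (2 * k)%:R != 0 :> R by rewrite pnatr_eq0 muln_eq0 -lt0n.
by apply: (mulfI k2_neq0); rewrite mulr_natl h divff.
Qed.

Definition neg_label (y : label k) : label k :=
  match y with inl c => inl (~~ c) | inr x => inr (x.1, ~~ x.2) end.

Definition neg (l : lab) : lab := [ffun v => neg_label (l v)].

Lemma negK : involutive neg.
Proof.
move=> l; apply/ffunP => v; rewrite !ffunE.
by case: (l v) => [c|[i b]] /=; rewrite negbK.
Qed.

Lemma neg_labellings l : l \in labellings k t -> neg l \in labellings k t.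
Proof.
move=> /labellingsP hl; apply/labellingsP => v; rewrite ffunE.
by move: (hl v); case: (l v).
Qed.

Lemma prob_neg E : Pr (E \o neg) = Pr E.
Proof. by apply: prob_involution; [exact: negK|exact: neg_labellings]. Qed.

(** This fuel is positive at every node, drops by one at each child and equals [#|V|] at the root,
    so the values obey the recursion [nvalE], in which no fuel appears. *)
Definition nval l a v := node_val t (#|V| - depth t v) l a v.

Lemma nvalE l a v : nval l a v =
  match l v with
  | inr x => lit_val x a
  | inl true => [forall u, child t v u ==> nval l a u]
  | inl false => [exists u, child t v u && nval l a u]
  end.
Proof.
have child_nval u : child t v u ->
    node_val t (#|V| - depth t v).-1 l a u = nval l a u.
  by move=> vu; rewrite /nval (depth_child vu) subnS.
rewrite {1}/nval; have := depth_lt_card t v; rewrite -subn_gt0.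
case: (#|V| - _)%N child_nval => // m child_nval _ /=.
case: (l v) => [[]|//]; first exact: eq_forallb_in.
exact: eq_existsb_in.
Qed.

Lemma represented_nval l a : represented t l a = nval l a (troot t).
Proof. by rewrite ffunE /nval depth_root subn0. Qed.

Lemma nval_neg l a v : nval (neg l) a v = ~~ nval l a v.
Proof.
elim/(@child_ind _ t): v => v IHv; rewrite !nvalE ffunE.
case: (l v) => [[]|[i b]] /=.
- by rewrite negb_forall_in; apply: eq_existsb_in.
- by rewrite negb_exists_in; apply: eq_forallb_in.
- by rewrite /lit_val /=; case: b; rewrite ?negbK.
Qed.

Lemma eq_nval l l' a v : {in desc t v, l =1 l'} -> nval l a v = nval l' a v.
Proof.
elim/(@child_ind _ t): v => v IHv ll'.
have IH u : child t v u -> nval l a u = nval l' a u.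
  by move=> vu; apply: IHv => // w /(fintype.subsetP (desc_child vu)) /ll'.
rewrite !nvalE ll' ?desc_refl//; case: (l' v) => [[]|//].
  exact: eq_forallb_in.
exact: eq_existsb_in.
Qed.

End Labels.

(** * Two inequalities in which arity two is the extremal case *)

Section PowerInequalities.
Context (R : realFieldType).
Implicit Types (x : R) (d : nat).

Lemma half_exp_sub_le x d : 0 <= x <= 1 / 2 -> (2 <= d)%N ->
  (1 / 2) ^+ d - x ^+ d <= 1 / 4 - x ^+ 2.
Proof.
move=> /andP[x0 xh]; elim: d => // d IHd.
rewrite ltnS leq_eqVlt => /predU1P[<-|d2].
  by rewrite !expr2; lra.
apply: le_trans (IHd d2); rewrite -(prednK (ltnW d2)).
have xd : x ^+ d.-1 <= (1 / 2) ^+ d.-1 by apply: lerXn2r; rewrite ?nnegrE; lra.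
have x_ge0 : 0 <= x ^+ d.-1 by rewrite exprn_ge0.
rewrite !exprS; move: (x ^+ _) ((1 / 2) ^+ _) xd x_ge0 => y z yz y0.
(* This is x (1 - x) <= 1/4 times y; with y <= z it shows that the left-hand side does not increase
   with the exponent. *)
have : 0 <= y * (1 / 2 - x) ^+ 2 by rewrite mulr_ge0 ?sqr_ge0.
by rewrite expr2; lra.
Qed.

Lemma two_mul_le_exp x d : 0 <= x <= 1 / 2 -> (2 <= d)%N ->
  2 * x <= x ^+ d + 1 - (1 - x) ^+ d.
Proof.
move=> /andP[x0 xh]; elim: d => // d IHd.
rewrite ltnS leq_eqVlt => /predU1P[<-|d2].
  by rewrite !expr2; nra.
apply: le_trans (IHd d2) _; rewrite -(prednK (ltnW d2)).
have xd : x ^+ d.-1 <= (1 - x) ^+ d.-1 by apply: lerXn2r; rewrite ?nnegrE; lra.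
rewrite !exprS; move: (x ^+ _) ((1 - x) ^+ _) xd => y z yz.
(* The product is the increment of the right-hand side when the exponent grows by one; at exponent 2
   that side equals 2 x. *)
have : 0 <= x * (1 - x) * (z - y) by rewrite !mulr_ge0//; lra.
by nra.
Qed.

End PowerInequalities.

Lemma card_child_gt1 (V : finType) (t : rtree V) v :
  no_unary_node t -> (exists u, child t v u) -> (1 < #|child t v|)%N.
Proof.
move=> t_nu [u vu]; rewrite ltnNge; apply/negP => /card_le1_eqP vu1.
by apply: (t_nu v); exists u; split=> // w vw; apply: vu1.
Qed.

(** * Part (a): the probability that two assignments are separated *)

Section Values.
Context (R : realType) (k : nat) (k_gt0 : (0 < k)%N).
Context (V : finType) (t : rtree V).
Context (t_nu : no_unary_node t).
Local Notation lab := {ffun V -> label k}.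
Local Notation Pr := (prob R t).
Local Notation nval := (nval t).
Implicit Types (E F G : pred lab) (l : lab) (a b : {ffun 'I_k -> bool}).

Definition differ a b v l := nval l a v != nval l b v.

Lemma prob_nval a v : Pr (fun l => nval l a v) = 1 / 2.
Proof.
have := prob_predC R k_gt0 t (fun l => nval l a v).
have -> : Pr (fun l => ~~ nval l a v) = Pr (fun l => nval l a v).
  by rewrite -[RHS]prob_neg; apply: eq_prob => l _; rewrite /= nval_neg.
by move=> h; lra.
Qed.

(** Negation exchanges the events that both values are true and that both are false, so each takes
    half of the complement of [differ]. *)
Lemma prob_nval2 a b v :
  Pr (fun l => nval l a v && nval l b v) = (1 - Pr (differ a b v)) / 2.
Proof.
have := prob_predC R k_gt0 t (differ a b v).
rewrite (prob_split R t (fun l => nval l a v)).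
have -> : Pr (fun l => ~~ differ a b v l && ~~ nval l a v) =
          Pr (fun l => nval l a v && nval l b v).
  rewrite -prob_neg; apply: eq_prob => l _ /=; rewrite /differ !nval_neg.
  by case: (nval l a v) (nval l b v) => [] [].
rewrite (eq_prob _ (F := fun l => nval l a v && nval l b v)); last first.
  by move=> l _; rewrite /differ; case: (nval l a v) (nval l b v) => [] [].
by move=> h; lra.
Qed.

Lemma prob_differ_node a b v : (exists u, child t v u) ->
  Pr (differ a b v) =
  2 * ((1 / 2) ^+ #|child t v| -
       \prod_(u | child t v u) ((1 - Pr (differ a b u)) / 2)).
Proof.
move=> v_int; have half c := prob_connective R k_gt0 c v_int.
(* Taking [P] on whole valuations lets the events for [a], for [b] and for both share one product
   formula. *)
pose allv (P : pred ({ffun 'I_k -> bool} -> bool)) l :=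
  (l v == inl true) && [forall u, child t v u ==> P (fun a => nval l a u)].
have allvE P : Pr (allv P) =
    1 / 2 * \prod_(u | child t v u) Pr (fun l => P (fun a => nval l a u)).
  rewrite (@prob_label_children R k k_gt0 V t v (inl true)
    (fun u l => P (fun a => nval l a u))) ?half// => u vu l l' ll'.
  by congr P; apply/funext => c; apply: eq_nval.
pose A := allv (fun f => f a); pose B := allv (fun f => f b).
pose AB := allv (fun f => f a && f b).
have prA c : Pr (allv (fun f => f c)) = 1 / 2 * (1 / 2) ^+ #|child t v|.
  rewrite allvE (eq_bigr (fun=> 1 / 2)) ?prodr_const// => u _.
  exact: prob_nval.
have prAB : Pr AB =
    1 / 2 * \prod_(u | child t v u) ((1 - Pr (differ a b u)) / 2).
  by rewrite allvE; congr (_ * _); apply: eq_bigr => u _; exact: prob_nval2.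
have A_and_B l : A l && B l = AB l.
  rewrite /A /B /AB /allv andbACA andbb; congr andb.
  apply/andP/forall_inP => [[/forall_inP ha /forall_inP hb] u vu|h].
    by rewrite ha ?hb.
  by split; apply/forall_inP => u /h/andP[].
have allv_nval l c : l v == inl true -> nval l c v = allv (fun f => f c) l.
  by move=> /eqP lv; rewrite nvalE /allv lv eqxx.
rewrite (prob_split R t (fun l => l v == inl true)).
(* Negation carries disjunctions at [v] to conjunctions and preserves [differ]; this gives the
   factor 2. Literals are excluded because [v] has a child. *)
have -> : Pr (fun l => differ a b v l && (l v != inl true)) =
    Pr (fun l => differ a b v l && (l v == inl true)).
  rewrite -prob_neg; apply: eq_prob => l /labellingsP/(_ v).
  rewrite /differ /= !nval_neg ffunE (inj_eq negb_inj).
  case: (l v) => [[]//|x] /=.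
  by case: v_int => u vu /forallP/(_ u); rewrite vu.
rewrite -[LHS]mulr2n -[LHS]mulr_natl; congr (_ * _).
rewrite (eq_prob _ (F := fun l => A l != B l)); last first.
  move=> l _ /=; case: (boolP (l v == inl true)) => lv.
    by rewrite andbT /differ !allv_nval.
  by rewrite andbF /A /B /allv (negPf lv).
(* The symmetric difference of [A] and [B] has probability P(A) + P(B) - 2 P(AB). *)
have Ea := prob_split R t B A; have Eb := prob_split R t A B.
rewrite [X in X + _](eq_prob _ (F := AB)) in Ea => [|l _]; last exact: A_and_B.
rewrite [X in X + _](eq_prob _ (F := AB)) in Eb => [|l _]; last first.
  by rewrite andbC; exact: A_and_B.
rewrite prAB prA in Ea; rewrite prAB prA in Eb.
rewrite (prob_split R t A).
rewrite (eq_prob _ (F := fun l => A l && ~~ B l)) => [|l _]; last first.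
  by case: (A l) (B l) => [] [].
rewrite [X in _ + X](eq_prob _ (F := fun l => B l && ~~ A l)) => [|l _].
  by lra.
by case: (A l) (B l) => [] [].
Qed.

(** Replace every child's probability by [x] and apply [half_exp_sub_le] at (1 - x) / 2: 2 (1/4 - (1
    - x)^2 / 4) = x - x^2 / 2. *)
Lemma prob_differ_node_le a b v (x : R) :
    (exists u, child t v u) -> 0 <= x <= 1 ->
    (forall u, child t v u -> Pr (differ a b u) <= x) ->
  Pr (differ a b v) <= x - x ^+ 2 / 2.
Proof.
move=> v_int x01 le_x; rewrite prob_differ_node//.
have d2 := card_child_gt1 t_nu v_int.
have : ((1 - x) / 2) ^+ #|child t v| <=
    \prod_(u | child t v u) ((1 - Pr (differ a b u)) / 2).
  by rewrite -prodr_const; apply: ler_prod => u /le_x; lra.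
have x2 : 0 <= (1 - x) / 2 <= 1 / 2 by lra.
by have := half_exp_sub_le x2 d2; nra.
Qed.

Lemma prob_differ_depth h :
    (forall v, (depth t v < h)%N -> exists u, child t v u) ->
  forall a b j v, (depth t v + j)%N = h ->
  Pr (differ a b v) <= 2 / (j + 2)%:R.
Proof.
move=> h_int a b; elim=> [|j IHj] v vh; first by rewrite divff ?prob_le1.
have v_int : exists u, child t v u by apply: h_int; lia.
set y : R := (j + 2)%:R; have y2 : 2 <= y by rewrite ler_nat leq_addl.
have y01 : 0 <= 2 / y <= 1.
  by rewrite divr_ge0 ?ler_pdivrMr ?mul1r//; lra.
apply: le_trans (prob_differ_node_le v_int y01 _) _ => [u vu|].
  by apply: IHj; rewrite (depth_child vu); lia.
clear vh; have -> : (j.+1 + 2)%:R = y + 1 by rewrite /y -addn1 !natrD; lra.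
(* This is at most 2 / (y + 1) because (y - 1) (y + 1) <= y^2, which closes the induction. *)
have -> : 2 / y - (2 / y) ^+ 2 / 2 = 2 * (y - 1) / y ^+ 2.
  by field; rewrite gt_eqF; lra.
rewrite ler_pdivrMr ?exprn_gt0; try lra.
by rewrite mulrAC ler_pdivlMr; [rewrite expr2; nra | lra].
Qed.

Lemma Pk_prob g : Pk k t R g = Pr (fun l => represented t l == g).
Proof. by []. Qed.

Lemma Pk_TrueF_FalseF : Pk k t R (TrueF k) = Pk k t R (FalseF k).
Proof.
rewrite !Pk_prob -prob_neg; apply: eq_prob => l _ /=.
by apply/eqP/eqP => /ffunP h; apply/ffunP => a; have := h a;
  rewrite !represented_nval nval_neg !ffunE => /eqP; case: (nval _ _ _).
Qed.

Lemma TrueF_FalseF : TrueF k != FalseF k.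
Proof. by apply/eqP => /ffunP/(_ [ffun=> true]); rewrite !ffunE. Qed.

Lemma Pk_TrueF_le : Pk k t R (TrueF k) <= 1 / 2.
Proof.
have : Pk k t R (TrueF k) + Pk k t R (FalseF k) <= 1.
  rewrite -(prob_predT R k_gt0 t) !Pk_prob.
  rewrite (prob_split R t (fun l => represented t l == TrueF k) xpredT).
  rewrite lerD ?le_prob// => l /eqP -> /=; rewrite eq_sym; exact: TrueF_FalseF.
by rewrite -Pk_TrueF_FalseF; lra.
Qed.

(** A nonconstant function separates some pair of assignments at the root. The union bound over
    ordered pairs controls the mass missing from True and False together, and half of it is missing
    from each. *)
Lemma Pk_TrueF_ge h : (forall v, (depth t v < h)%N -> exists u, child t v u) ->
  1 / 2 - (#|{ffun 'I_k -> bool}| ^ 2)%:R / (h + 2)%:R <= Pk k t R (TrueF k).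
Proof.
move=> h_int; suff : 1 - (Pk k t R (TrueF k) + Pk k t R (FalseF k)) <=
    (#|{ffun 'I_k -> bool}| ^ 2)%:R * (2 / (h + 2)%:R).
  by rewrite -Pk_TrueF_FalseF; move: (_%:R) ((_ + _)%:R^-1) => y z; lra.
pose diff p l := differ p.1 p.2 (troot t) l.
apply: (@le_trans _ _ (Pr (fun l => [exists p, diff p l]))); last first.
  apply: le_trans (prob_exists _ _ _) _.
  rewrite mulr_natl -mulnn -card_prod -sumr_const ler_sum// => p _.
  by apply: prob_differ_depth => //; rewrite depth_root.
pose T l := represented t l == TrueF k; pose F l := represented t l == FalseF k.
rewrite !Pk_prob -/T -/F opprD addrA -(prob_predC R k_gt0).
rewrite (prob_split R t F (fun l => ~~ T l)).
suff: Pr (fun l => ~~ T l && F l) <= Pr F /\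
      Pr (fun l => ~~ T l && ~~ F l) <= Pr (fun l => [exists p, diff p l]).
  by case; lra.
split; apply: le_prob => l /=; first by case/andP.
move=> /andP[nT nF]; apply/existsP.
have [a fa] : exists a, ~~ represented t l a.
  apply/existsP; rewrite -negb_forall; apply: contra nT => /forallP ft.
  by apply/eqP/ffunP => a; rewrite [RHS]ffunE ft.
have [b fb] : exists b, represented t l b.
  apply/existsP; apply: contraR nF => /existsPn ff.
  by apply/eqP/ffunP => b; rewrite [RHS]ffunE; apply/negbTE.
by exists (a, b); rewrite /diff /differ /= -!represented_nval (negbTE fa) fb.
Qed.

End Values.

(** * Part (b): a lower bound for the probability of a literal *)

Section LiteralProbability.
Context (R : realType) (k : nat) (k_gt0 : (0 < k)%N).
Context (V : finType) (t : rtree V).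
Context (t_nu : no_unary_node t) (i0 : 'I_k).
Local Notation lab := {ffun V -> label k}.
Local Notation Pr := (prob R t).
Local Notation nval := (nval t).
Implicit Types (l : lab) (a : {ffun 'I_k -> bool}).

Definition above_lit v l :=
  [forall a : {ffun 'I_k -> bool}, a i0 ==> nval l a v].

Definition equals_lit v l :=
  [forall a : {ffun 'I_k -> bool}, nval l a v == a i0].

Lemma above_lit_desc v : depends_on (desc t v) (above_lit v).
Proof. by move=> l l' ll'; apply: eq_forallb => a; rewrite (eq_nval _ ll'). Qed.

Lemma equals_lit_desc v : depends_on (desc t v) (equals_lit v).
Proof. by move=> l l' ll'; apply: eq_forallb => a; rewrite (eq_nval _ ll'). Qed.

Let x0 : R := (2 * k)%:R^-1.

Lemma x0_bounds : 0 < x0 <= 1 / 2.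
Proof.
have k1 : (1 : R) <= k%:R by rewrite ler1n.
rewrite /x0 natrM invr_gt0; apply/andP; split; first by lra.
by rewrite mul1r lef_pV2 ?posrE; lra.
Qed.

Lemma prob_above_lit_ge v : x0 <= Pr (above_lit v).
Proof.
have /andP[x0_gt0 x0_half] := x0_bounds.
elim/(@child_ind _ t): v => v IHv.
case: (boolP [exists u, child t v u]) => [/existsP v_int|/existsPn v_leaf].
  2: rewrite /x0 -(prob_literal R k_gt0 (i0, true) v_leaf).
  2: apply: le_prob => l /eqP lv; apply/forallP => a.
  2: by apply/implyP; rewrite nvalE lv.
have half c := prob_connective R k_gt0 c v_int.
rewrite (prob_split R t (fun l => l v == inl true)).
(* A conjunction dominates the literal when all its children do. *)
have and_ge : 1 / 2 * x0 ^+ #|child t v| <=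
    Pr (fun l => above_lit v l && (l v == inl true)).
  apply: (@le_trans _ _ (Pr (fun l => (l v == inl true) &&
      [forall u, child t v u ==> above_lit u l]))).
    rewrite prob_label_children ?half ?ler_wpM2l//; last first.
      by move=> u _; exact: above_lit_desc.
    by rewrite -prodr_const; apply: ler_prod => u /IHv ->; rewrite ltW.
  apply: le_prob => l /andP[/eqP lv /forall_inP h]; rewrite lv eqxx andbT.
  apply/forall_inP => a ai; rewrite nvalE lv; apply/forall_inP => u /h.
  by move=> /forall_inP; apply.
(* A disjunction dominates the literal as soon as one child does. *)
have or_ge : 1 / 2 - 1 / 2 * (1 - x0) ^+ #|child t v| <=
    Pr (fun l => above_lit v l && (l v != inl true)).
  apply: (@le_trans _ _ (Pr (fun l => (l v == inl false) &&
      ~~ [forall u, child t v u ==> ~~ above_lit u l]))); last first.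
    apply: le_prob => l; rewrite negb_forall_in => /andP[/eqP lv].
    move=> /exists_inP[u vu]; rewrite negbK lv andbT => /forall_inP h.
    apply/forall_inP => a ai; rewrite nvalE lv; apply/exists_inP.
    by exists u; rewrite ?h.
  have := prob_split R t (fun l => [forall u, child t v u ==> ~~ above_lit u l])
    (fun l => l v == inl false).
  rewrite half prob_label_children//; last first.
    by move=> u _ l l' ll'; rewrite (above_lit_desc ll').
  rewrite half.
  suff : \prod_(u | child t v u) Pr (fun l => ~~ above_lit u l) <=
      (1 - x0) ^+ #|child t v| by lra.
  rewrite -prodr_const; apply: ler_prod => u /IHv.
  by rewrite prob_ge0 prob_predC// lerD2l lerN2.
have := two_mul_le_exp (x := x0) _ (card_child_gt1 t_nu v_int).
by rewrite (ltW x0_gt0) x0_half => /(_ isT); lra.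
Qed.

(** One factor [x0], at most 1/2, pays for the conjunction at [v]; the others pay for the siblings
    of [c] being above the literal. *)
Lemma prob_equals_lit_child v c : child t v c ->
  x0 ^+ #|child t v| * Pr (equals_lit c) <= Pr (equals_lit v).
Proof.
have /andP[x0_gt0 x0_half] := x0_bounds => vc.
have v_int : exists u, child t v u by exists c.
pose E u := if u == c then equals_lit u else above_lit u.
apply: (@le_trans _ _ (Pr (fun l => (l v == inl true) &&
    [forall u, child t v u ==> E u l]))); last first.
  apply: le_prob => l /andP[/eqP lv /forall_inP h]; apply/forallP => a.
  have := h _ vc; rewrite /E eqxx => /forallP/(_ a)/eqP ca.
  rewrite nvalE lv; apply/eqP; apply/idP/idP => [/forall_inP/(_ c vc)|ai].
    by rewrite ca.
  apply/forall_inP => u vu.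
  have := h _ vu; rewrite /E; case: eqP => [->|_]; first by rewrite ca.
  by move/forall_inP; apply.
rewrite prob_label_children//; last first.
  move=> u _; rewrite /E; case: ifP => _; first exact: equals_lit_desc.
  exact: above_lit_desc.
rewrite prob_connective// (bigD1 c)//= {1}/E eqxx /=.
rewrite [leRHS]mulrCA [leLHS]mulrC ler_wpM2l ?prob_ge0//.
have : x0 ^+ #|child t v|.-1 <= \prod_(u | child t v u && (u != c)) Pr (E u).
  have -> : #|child t v|.-1 = #|[pred u | child t v u && (u != c)]|.
    rewrite (cardD1 c) [c \in _]vc /=; apply: eq_card => u.
    by rewrite !inE andbC.
  rewrite -prodr_const; apply: ler_prod => u /andP[_ /negPf uc].
  by rewrite ltW//= /E uc prob_above_lit_ge.
have : (0 < #|child t v|)%N by apply/card_gt0P; exists c.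
case: #|_| => // d _ /= h; rewrite exprS; apply: ler_pM => //; try lra.
by rewrite exprn_ge0 ?ltW.
Qed.

(** Climbing from [w], the leaf label costs one factor [x0] and each level at most [M] more; all
    proper ancestors of [w] have depth below [h], where [M] bounds the arity. *)
Lemma Pk_literal_ge h M w :
    (forall v, (depth t v < h)%N -> (#|child t v| <= M)%N) ->
    is_leaf t w -> (depth t w <= h)%N ->
  x0 ^+ (M * depth t w).+1 <= Pk k t R [ffun a : {ffun 'I_k -> bool} => a i0].
Proof.
move=> leM w_leaf wh; have /andP[x0_gt0 x0_half] := x0_bounds.
have up j : (j <= depth t w)%N ->
    x0 ^+ (M * j).+1 <= Pr (equals_lit (iter j (parent t) w)).
  elim: j => [_|j IHj jw] /=.
    rewrite muln0 expr1 /x0 -(prob_literal R k_gt0 (i0, true) w_leaf).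
    by apply: le_prob => l /eqP lw; apply/forallP => a; rewrite nvalE lw.
  set c := iter j _ _ in IHj *.
  have vc : child t (parent t c) c.
    rewrite /child eqxx andbT; apply/eqP => /depth_le; lia.
  apply: le_trans (prob_equals_lit_child vc).
  have deg_le : (#|child t (parent t c)| <= M)%N.
    apply: leM; apply: leq_trans wh; rewrite -ltnS -(depth_child vc) ltnS.
    exact: depth_iter.
  rewrite mulnS -addnS exprD ler_pM ?exprn_ge0 ?(ltW x0_gt0)//; last first.
    exact/IHj/ltnW.
  by rewrite ler_wiXn2l ?(ltW x0_gt0)//; lra.
apply: le_trans (up _ (leqnn _)) _; rewrite iter_depth.
apply: le_prob => l /forallP h0.
by apply/eqP/ffunP => a; rewrite represented_nval ffunE; apply/eqP.
Qed.

End LiteralProbability.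

(** * Transfer of nodes and sizes between isomorphic truncations *)

Section Isomorphism.

Lemma depth_trunc (V : eqType) (t : rtree V) h v :
  depth (trunc t h) v = depth t (val v).
Proof.
have val_iter n :
    val (iter n (parent (trunc t h)) v) = iter n (parent t) (val v).
  by elim: n => //= n <-.
apply/eqP; rewrite eqn_leq; apply/andP; split; apply: depth_le.
  by apply/val_inj; rewrite val_iter iter_depth.
by rewrite -val_iter iter_depth.
Qed.

Lemma child_trunc (V : eqType) (t : rtree V) h v u :
  child (trunc t h) v u = child t (val v) (val u).
Proof. by []. Qed.

Lemma rtree_iso_sym (V W : eqType) (s : rtree V) (t : rtree W) :
  rtree_iso s t -> rtree_iso t s.
Proof.
move=> [phi [[psi phiK psiK] phi_root phi_parent]]; exists psi; split.
- by exists phi.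
- by rewrite -phi_root phiK.
- by move=> w; rewrite -[in LHS](psiK w) -phi_parent phiK.
Qed.

Lemma rtree_iso_depth_child (V W : eqType) (s : rtree V) (t : rtree W) :
  rtree_iso s t -> exists phi : V -> W,
    [/\ bijective phi, forall v, depth t (phi v) = depth s v &
        forall v u, child t (phi v) (phi u) = child s v u].
Proof.
move=> [phi [phi_bij phi_root phi_parent]]; exists phi; split=> //.
  have phi_iter n v : phi (iter n (parent s) v) = iter n (parent t) (phi v).
    by elim: n => //= n <-.
  move=> v; apply/eqP; rewrite eqn_leq; apply/andP; split; apply: depth_le.
    by rewrite -phi_iter iter_depth.
  by apply: (bij_inj phi_bij); rewrite phi_iter iter_depth phi_root.
by move=> v u; rewrite /child -phi_root -phi_parent !(inj_eq (bij_inj phi_bij)).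
Qed.

(** As [w] lies strictly above level [h], the children of its image survive truncation and can be
    carried back. *)
Lemma trunc_iso_node (V W : eqType) (s : rtree V) (t : rtree W) h w :
    rtree_iso (trunc s h) (trunc t h) -> (depth s w < h)%N ->
  exists2 v, depth t v = depth s w &
    (exists u, child t v u) -> exists u, child s w u.
Proof.
move=> /rtree_iso_depth_child[phi [[psi phiK psiK] phi_depth phi_child]] wh.
pose w' : trunc_node s h := exist _ w (ltnW wh); exists (val (phi w')).
  by rewrite -depth_trunc phi_depth depth_trunc.
move=> [u vu]; have uh : (depth t u <= h)%N.
  by rewrite (depth_child vu) -depth_trunc phi_depth depth_trunc.
exists (val (psi (exist _ u uh))).
by rewrite -[w]/(val w') -child_trunc -phi_child psiK.
Qed.

(** The comparison goes through the truncation of [s], so that no cardinality is taken on [W], which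
    may be infinite. *)
Lemma card_trunc_iso (V V' : finType) (W : eqType) (t : rtree V) (t' : rtree V')
    (s : rtree W) h :
    rtree_iso (trunc t h) (trunc s h) -> rtree_iso (trunc t' h) (trunc s h) ->
  #|[pred v | (depth t v <= h)%N]| = #|[pred v | (depth t' v <= h)%N]|.
Proof.
move=> [phi [phi_bij _ _]] [phi' [[psi' phi'K psi'K] _ _]].
rewrite -(card_sig (fun v => depth t v <= h)%N).
rewrite -(card_sig (fun v => depth t' v <= h)%N).
apply: (@bij_eq_card _ _ (psi' \o phi)).
by apply: bij_comp phi_bij; exists phi'.
Qed.

Lemma card_child_le (V : finType) (t : rtree V) h v : (depth t v < h)%N ->
  (#|child t v| <= #|[pred v | (depth t v <= h)%N]|)%N.
Proof.
move=> vh; apply/subset_leq_card/fintype.subsetP => u vu.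
by rewrite inE (depth_child vu).
Qed.

End Isomorphism.

(** * Passage to the limit *)

Local Open Scope classical_set_scope.

Lemma limn_inf_ge (R : realType) (u : nat -> R) (c b : R) N :
    (forall n, 0 <= u n <= b) -> (forall n, (N <= n)%N -> c <= u n) ->
  c <= limn_inf u.
Proof.
move=> ub uc; have u_ub : has_ubound (range u).
  by exists b => _ [n _ <-]; case/andP: (ub n).
have u_lb : has_lbound (range u).
  by exists 0 => _ [n _ <-]; case/andP: (ub n).
apply: limr_ge; first by apply/cvg_ex; eexists; exact: cvg_infs_sup.
near=> n; apply: lb_le_inf; first by exists (u n), n => /=.
move=> _ [m /= nm <-]; apply: uc; apply: leq_trans nm.
by near: n; exact: nbhs_infty_ge.
Unshelve. all: by end_near. Qed.

Unset Implicit Arguments.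

Theorem theorem2p1 (R : realType) (k : nat) (k_ge1 : (1 <= k)%N) :
  (forall (V : nat -> finType) (t : forall n, rtree (V n))
      (W : eqType) (s : rtree W),
    (forall n, no_unary_node (t n)) -> no_unary_node s ->
    converges_locally t s ->
    infinite_set [set: W] -> (forall w, ~ is_leaf s w) ->
    (forall n, Pk k (t n) R (TrueF k) = Pk k (t n) R (FalseF k)) /\
    Pk k (t n) R (TrueF k) @[n --> \oo] --> (1 / 2 : R)) /\
  (forall (V : nat -> finType) (t : forall n, rtree (V n))
      (W : eqType) (s : rtree W),
    (forall n, no_unary_node (t n)) -> no_unary_node s ->
    converges_locally t s ->
    (exists w, is_leaf s w) ->
    exists f : boolfun k, f <> TrueF k /\ f <> FalseF k /\
      0 < limn_inf (fun n => Pk k (t n) R f)).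
Proof.
split=> V t W s t_nu _ t_s.
  move=> _ s_int; split=> [n|]; first exact: Pk_TrueF_FalseF.
  apply/cvgrPdist_le => e e_gt0; set C : R := (#|{ffun 'I_k -> bool}| ^ 2)%:R.
  have C_ge0 : 0 <= C by [].
  (* Full branching above level m + 1 leaves an error of at most C / (m + 3), which this choice
     brings below [e]. *)
  have [m Cem] : exists m, C / e <= m%:R.
    by exists (Num.truncn (C / e)).+1; rewrite ltW// truncnS_gt.
  have [N tN] := t_s m.+1 isT; near=> n.
  have n_int v : (depth (t n) v < m.+1)%N -> exists u, child (t n) v u.
    move=> vm; have nN : (N <= n)%N by near: n; exact: nbhs_infty_ge.
    have [w _] := trunc_iso_node (tN n nN) vm; apply.
    apply: contrapT => w_leaf; apply: (s_int w) => u; apply/negP => wu.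
    by apply: w_leaf; exists u.
  have := Pk_TrueF_ge R k_ge1 (t_nu n) n_int; rewrite -/C => ge_half.
  rewrite ger0_norm ?subr_ge0; last exact: Pk_TrueF_le.
  have : C / (m.+1 + 2)%:R <= e.
    rewrite ler_pdivrMr// mulrC -ler_pdivrMr//; apply: le_trans Cem _.
    by rewrite ler_nat; lia.
  by lra.
move=> [w w_leaf]; pose i0 := Ordinal k_ge1.
exists [ffun a : {ffun 'I_k -> bool} => a i0]; split; [|split].
- by move/ffunP/(_ [ffun=> false]); rewrite !ffunE.
- by move/ffunP/(_ [ffun=> true]); rewrite !ffunE.
(* One level beyond [w] is kept so that the truncation shows that [w] has no child. *)
have [N tN] := t_s (depth s w).+1 isT.
(* From [N] on all truncations at this level have the same size, so [M] bounds the relevant arities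
   uniformly in [n]. *)
pose M := #|[pred v | (depth (t N) v <= (depth s w).+1)%N]|.
pose c : R := (2 * k)%:R^-1 ^+ (M * depth s w).+1.
have c_gt0 : 0 < c by rewrite exprn_gt0// invr_gt0 ltr0n muln_gt0.
apply: lt_le_trans c_gt0 _; apply: (@limn_inf_ge _ _ _ 1 N) => n.
  by rewrite Pk_prob prob_ge0 prob_le1.
move=> nN.
have [v vw v_int] := trunc_iso_node (rtree_iso_sym (tN n nN)) (ltnSn _).
have v_leaf : is_leaf (t n) v.
  move=> u; apply/negP => vu; have [|u' wu'] := v_int; first by exists u.
  by move: (w_leaf u'); rewrite wu'.
rewrite /c -vw.
apply: (Pk_literal_ge _ k_ge1 (t_nu n) _ (h := (depth s w).+1)) => //.
  move=> x xh; rewrite /M (card_trunc_iso (tN N (leqnn N)) (tN n nN)).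
  exact: card_child_le.
by rewrite vw.
Unshelve. all: by end_near. Qed.
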